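(* For $i=1,2$ consider forward complete systems $\Sigma_i:\ \frac{d}{dt}x_i(t)=f_i(x_i(t),w_i(t))$ with $x_i(0)\in\mathbb{R}^{n_i}$, $w_i\in\mathcal{W}^{m_i}$, where $f_i:\mathbb{R}^{n_i}\times\mathbb{R}^{m_i}\to\mathbb{R}^{n_i}$ is locally Lipschitz in its first argument, locally uniformly in its second argument, and $m_1=n_2$, $m_2=n_1$. Suppose both systems are iISS with functions $\alpha_i,\beta_i,\gamma_i,\sigma_i\in\mathcal{K}_\infty$: $$\int_0^t\alpha_i(|x_i(\tau)|)d\tau\le\max\left\{\beta_i(|x_i(0)|),\ \gamma_i\left(\int_0^t\sigma_i(|w_i(\tau)|)d\tau\right)\right\}$$ for all $x_i(0)\in\mathbb{R}^{n_i}$, $w_i\in\mathcal{W}^{m_i}$, $t\ge0$. Suppose the systems are connected in feedback with $w_1=x_2+\eta_1$ and $w_2=x_1+\eta_2$, with external inputs $\eta_i\in\mathcal{W}^{m_i}$, and this interconnection is forward complete. If there exist $c_i>0$ and $\rho_i\in\mathcal{K}_\infty$ with $\rho_i-\mathrm{Id}\in\mathcal{K}_\infty$, $i=1,2$, such that $$\sigma_i\circ\rho_i(s)\le c_j\,\alpha_j(s)\quad\text{for all }s\in\mathbb{R}_{\ge0}$$ for $i,j=1,2$, $i\ne j$, and if there exists $\rho\in\mathcal{K}_\infty$ with $\rho-\mathrm{Id}\in\mathcal{K}_\infty$ such that, for $i,j=1,2$, $i\ne j$, the function $$s\mapsto s-\gamma_i\left(\rho\left(c_j\,\gamma_j(c_i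 s)\right)\right)$$ is of class $\mathcal{K}_\infty$, then the feedback interconnection is iISS (from input $\eta=[\eta_1^T\ \eta_2^T]^T$ to state $x=[x_1^T\ x_2^T]^T$); that is, there exist $\alpha,\beta,\gamma,\sigma\in\mathcal{K}_\infty$ such that $$\int_0^t\alpha(|x(\tau)|)d\tau\le\max\left\{\beta(|x(0)|),\ \gamma\left(\int_0^t\sigma(|\eta(\tau)|)d\tau\right)\right\}$$ for all $x(0)\in\mathbb{R}^{n_1+n_2}$, $\eta\in\mathcal{W}^{m_1+m_2}$, $t\ge0$.
   Context: $\mathcal{W}^m$ is the set of measurable, locally essentially bounded functions $w:\mathbb{R}_{\ge0}\to\mathbb{R}^m$. Forward complete means that for every initial condition and every input in the input class the solution exists for all $t\ge 0$. $\mathcal{K}_\infty$ is the class of continuous, strictly increasing, unbounded functions $\alpha:\mathbb{R}_{\ge0}\to\mathbb{R}_{\ge0}$ with $\alpha(0)=0$. $\mathrm{Id}$ is the identity on $\mathbb{R}_{\ge0}$. $|\cdot|$ is the Euclidean norm. iISS stands for integral input-to-state stable. *)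

(* Defs.v *)
From mathcomp Require Import all_boot all_order all_algebra.
From mathcomp Require Import all_classical all_reals all_analysis.

Set Implicit Arguments.
Unset Strict Implicit.
Unset Printing Implicit Defensive.

Import Order.TTheory GRing.Theory Num.Theory.
Import numFieldNormedType.Exports.

Local Open Scope classical_set_scope.
Local Open Scope ring_scope.

(* The real line with the Lebesgue-measurable sets (the completion of the Borel
   sets); its carrier is convertible to R. *)
Definition lebesgueType (R : realType) :=
  caratheodory_type
    ((wlength (idfun : R -> R) : set (ocitv_type R) -> \bar R)^*)%mu.

(* Lebesgue measure on all Lebesgue-measurable sets. *)
Local Notation leb := completed_lebesgue_measure.

(* Euclidean norm; the library norm on matrices is the sup norm. *)
Definition enorm (R : realType) (n : nat) (x : 'cV[R]_n) : R :=
  Num.sqrt (\sum_(i < n) x i ord0 ^+ 2).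

(* A function on the nonnegative reals is a function R -> R of which only the
   restriction to `[0, +oo[ is constrained or used. Nonnegativity of the values
   follows from a 0 = 0 and monotonicity. *)
Definition Kinf (R : realType) (a : R -> R) : Prop :=
  [/\ {within `[0, +oo[, continuous a},
      a 0 = 0,
      forall s t : R, 0 <= s -> s < t -> a s < a t
    & forall M : R, exists2 s : R, 0 <= s & M < a s].

(* Measurable, locally essentially bounded inputs on [0, +oo[; each compact
   subset of [0, +oo[ lies in some [0, T]. *)
Definition inputs (R : realType) (m : nat) (w : R -> 'cV[R]_m) : Prop :=
  (forall i : 'I_m,
     measurable_fun (`[0, +oo[ : set (lebesgueType R))
       ((fun t : R => w t i ord0) : lebesgueType R -> R)) /\
  (forall T : R, 0 <= T -> exists M : R,
     {ae leb, forall t : R, 0 <= t <= T -> enorm (w t) <= M}).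

Definition loc_lipschitz1 (R : realType) (n m : nat)
    (f : 'cV[R]_n -> 'cV[R]_m -> 'cV[R]_n) : Prop :=
  forall (x0 : 'cV[R]_n) (w0 : 'cV[R]_m),
  exists (U : set 'cV[R]_n) (V : set 'cV[R]_m) (L : R),
    [/\ nbhs x0 U, nbhs w0 V
      & forall w : 'cV[R]_m, V w -> L.-lipschitz_U (fun x => f x w)].

Definition abs_continuous (R : realType) (n : nat) (T : R)
    (x : R -> 'cV[R]_n) : Prop :=
  forall e : R, 0 < e -> exists2 d : R, 0 < d &
  forall (k : nat) (a b : 'I_k -> R),
    (forall i, [/\ 0 <= a i, a i <= b i & b i <= T]) ->
    (forall i j, i != j -> `]a i, b i[ `&` `]a j, b j[ = set0) ->
    \sum_(i < k) (b i - a i) < d ->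
    \sum_(i < k) enorm (x (b i) - x (a i)) < e.

(* Caratheodory solutions of x' = f(x, w) on [0, +oo[. *)
Definition solution (R : realType) (n m : nat)
    (f : 'cV[R]_n -> 'cV[R]_m -> 'cV[R]_n)
    (w : R -> 'cV[R]_m) (x : R -> 'cV[R]_n) : Prop :=
  (forall T : R, 0 <= T -> abs_continuous T x) /\
  {ae leb, forall t : R, 0 < t -> is_derive t 1 x (f (x t) (w t))}.

Definition forward_complete (R : realType) (n m : nat)
    (f : 'cV[R]_n -> 'cV[R]_m -> 'cV[R]_n) : Prop :=
  forall (x0 : 'cV[R]_n) (w : R -> 'cV[R]_m), inputs w ->
  exists2 x : R -> 'cV[R]_n, x 0 = x0 & solution f w x.

(* All integrands below are locally essentially bounded, so the real-valued
   integrals are the genuine (finite) ones. *)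
Definition iISS_estimate (R : realType) (n m : nat)
    (f : 'cV[R]_n -> 'cV[R]_m -> 'cV[R]_n) (a b g s : R -> R) : Prop :=
  forall (w : R -> 'cV[R]_m) (x : R -> 'cV[R]_n) (t : R),
    inputs w -> solution f w x -> 0 <= t ->
    \int[leb]_(r in `[0, t]) a (enorm (x r)) <=
    Num.max (b (enorm (x 0)))
            (g (\int[leb]_(r in `[0, t]) s (enorm (w r)))).

Definition iISS (R : realType) (n m : nat)
    (f : 'cV[R]_n -> 'cV[R]_m -> 'cV[R]_n) : Prop :=
  exists a b g s : R -> R,
    [/\ Kinf a, Kinf b, Kinf g & Kinf s] /\ iISS_estimate f a b g s.

(* x = (x1, x2) and v = (v1, v2); subsystem 1 is driven by x2 + v1, subsystem 2
   by x1 + v2. *)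
Definition feedback (R : realType) (n1 n2 : nat)
    (f1 : 'cV[R]_n1 -> 'cV[R]_n2 -> 'cV[R]_n1)
    (f2 : 'cV[R]_n2 -> 'cV[R]_n1 -> 'cV[R]_n2)
    (x : 'cV[R]_(n1 + n2)) (v : 'cV[R]_(n2 + n1)) : 'cV[R]_(n1 + n2) :=
  col_mx (f1 (usubmx x) (dsubmx x + usubmx v))
         (f2 (dsubmx x) (usubmx x + dsubmx v)).

(* Main.v *)
(** Write I_i for the integral of alpha_i(|x_i|) over [0, t]. Since each input
    satisfies |w_i| <= |x_j| + |eta_i|, the weak triangle inequality for sigma_i and
    the matching condition turn the two estimates into
      I_1 <= max (b_1, gamma_1 (c_2 I_2 + N_1)),
      I_2 <= max (b_2, gamma_2 (c_1 I_1 + N_2))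
    with b_i depending on x_i(0) only and N_i an integral of a K-infinity function
    of |eta_i|. If the input and initial terms do not already dominate, then
    I_1 <= gamma_1 (rho (c_2 gamma_2 (c_1 s))) with s = I_1 + N_2 / c_1, so that
    s - gamma_1 (rho (c_2 gamma_2 (c_1 s))) <= N_2 / c_1; inverting the left-hand
    side bounds s, hence I_1, in terms of N_2. All the integrals being finite, no
    limiting argument is needed. *)

Require Import Defs.
From mathcomp Require Import all_boot all_order all_algebra.
From mathcomp Require Import all_classical all_reals all_analysis.
From mathcomp Require Import measurable_realfun ring lra.

Set Implicit Arguments.
Unset Strict Implicit.

Import Order.TTheory GRing.Theory Num.Theory.
Import numFieldNormedType.Exports.

Local Open Scope classical_set_scope.
Local Open Scope ring_scope.

(** * Closure properties of K-infinity functions and the scalar small-gain argument *)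

Section Kinf_calculus.
Context {R : realType}.
Implicit Types a b : R -> R.

(** The clamp [Num.max 0] is a continuous retraction of the line onto [[0, +oo[]. Precomposing with
    it trades relative continuity for continuity on the whole line, where the usual closure rules
    apply. *)
Lemma within_ge0_continuousP a :
  {within `[0, +oo[, continuous a} <-> continuous (fun s : R => a (Num.max 0 s)).
Proof.
split=> [/subspace_continuousP ca s|ca].
- have max0 : `[0%R, +oo[%classic (Num.max 0 s).
    by rewrite /= in_itv/= andbT le_max lexx.
  apply: (cvg_comp (fun s : R => Num.max 0 s) a _ (ca _ max0)) => P.
  move=> nP; change (\forall u \near s, P (Num.max 0 u)).
  have /(_ _ nP) maxP : Num.max 0 u @[u --> s] --> Num.max 0 s.
    by apply: (@continuous_max _ R (cst 0) id); [exact: cvg_cst|exact: cvg_id].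
  near=> u; have : `[0, +oo[%classic (Num.max 0 u) -> P (Num.max 0 u).
    by near: u; exact: maxP.
  apply=> /=.
  by rewrite in_itv/= andbT le_max lexx.
- apply: (@subspace_eq_continuous _ _ _ (fun s : R => a (Num.max 0 s))).
    by move=> s; rewrite inE/= in_itv/= andbT => s0; rewrite (max_idPr s0).
  exact: continuous_subspaceT.
Unshelve. all: by end_near. Qed.

Lemma Kinf_ge0 a s : Kinf a -> 0 <= s -> 0 <= a s.
Proof.
move=> [_ a0 ai _]; rewrite le_eqVlt => /predU1P[<-|s0]; first by rewrite a0.
by rewrite -a0 ltW// ai.
Qed.

Lemma Kinf_le a s t : Kinf a -> 0 <= s -> s <= t -> a s <= a t.
Proof.
move=> [_ _ ai _] s0; rewrite le_eqVlt => /predU1P[->//|st].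
by rewrite ltW// ai.
Qed.

Lemma Kinf_le_inv a s t : Kinf a -> 0 <= t -> a s <= a t -> s <= t.
Proof.
move=> [_ _ ai _] t0 ast; rewrite leNgt; apply/negP => ts.
by have := ai _ _ t0 ts; rewrite ltNge ast.
Qed.

Lemma KinfD a b : Kinf a -> Kinf b -> Kinf (fun s => a s + b s).
Proof.
move=> Ka Kb; have [ca a0 ai au] := Ka; have [cb b0 bi _] := Kb; split.
- apply/within_ge0_continuousP => s.
  apply: cvgD; [exact: (within_ge0_continuousP a).1|
                   exact: (within_ge0_continuousP b).1].
- by rewrite a0 b0 addr0.
- by move=> s t s0 st; rewrite ltrD// (ai, bi).
- move=> M; have [s s0 Ms] := au M; exists s => //.
  by rewrite ltr_wpDr// (Kinf_ge0 Kb).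
Qed.

Lemma Kinf_comp a b : Kinf a -> Kinf b -> Kinf (fun s => a (b s)).
Proof.
move=> [ca a0 ai au] Kb; have [cb b0 bi bu] := Kb; split.
- apply/within_ge0_continuousP.
  (* As [b] is nonnegative at clamped arguments, a second clamp before [a] changes nothing. *)
  rewrite (_ : (fun _ => _) = (fun s : R => a (Num.max 0 s)) \o
                              (fun s : R => b (Num.max 0 s))); last first.
    apply/funext => s /=; congr a; apply/esym/max_idPr.
    by rewrite (Kinf_ge0 Kb)// le_max lexx.
  move=> s; apply: continuous_comp.
    exact: (within_ge0_continuousP b).1.
  exact: (within_ge0_continuousP a).1.
- by rewrite b0 a0.
- by move=> s t s0 st; rewrite ai ?bi// (Kinf_ge0 Kb).
- move=> M; have [u u0 Mu] := au M; have [s s0 us] := bu u.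
  by exists s => //; rewrite (lt_trans Mu)// ai.
Qed.

Lemma Kinf_scale (c : R) : 0 < c -> Kinf (fun s => c * s).
Proof.
move=> c0; split.
- by apply: continuous_subspaceT => s; apply: cvgM; [exact: cvg_cst|exact: cvg_id].
- by rewrite mulr0.
- by move=> s t _ st; rewrite ltr_pM2l.
- move=> M; exists ((`|M| + 1) / c); first by rewrite divr_ge0// ltW.
  by rewrite mulrC divfK ?gt_eqF// ltr_pwDr// ler_norm.
Qed.

Lemma Kinf_id : Kinf (fun s : R => s).
Proof.
have := @Kinf_scale 1 ltr01.
by congr Kinf; apply/funext => s; rewrite mul1r.
Qed.

Lemma Kinf_min a b : Kinf a -> Kinf b -> Kinf (fun s => Num.min (a s) (b s)).
Proof.
move=> Ka Kb; have [ca a0 ai au] := Ka; have [cb b0 bi bu] := Kb; split.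
- apply/within_ge0_continuousP => s.
  apply: (@continuous_min _ R); [exact: (within_ge0_continuousP a).1|
                                 exact: (within_ge0_continuousP b).1].
- by rewrite a0 b0 minxx.
- by move=> s t s0 st; rewrite lt_min !gt_min ai// bi// orbT.
- move=> M; have [s s0 Ms] := au M; have [t t0 Mt] := bu M.
  have st0 : 0 <= Num.max s t by rewrite le_max s0.
  exists (Num.max s t) => //; rewrite lt_min.
  by rewrite (lt_le_trans Ms) ?(lt_le_trans Mt)// Kinf_le// le_max lexx ?orbT.
Qed.

(** The witness is the inverse of [a]: the intermediate value theorem gives surjectivity onto [[0,
    +oo[], and the equivalences [bleP] and [bltP] carry monotonicity and continuity over from
    [a]. *)
Lemma Kinf_inverse a : Kinf a -> exists2 b, Kinf b &
  forall s y, 0 <= s -> a s <= y -> s <= b y.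
Proof.
move=> Ka; have [ca a0 ai au] := Ka.
(* The value 0 chosen at negative [y] is an arbitrary default. *)
have /choice[b bP] : forall y, exists s, 0 <= y -> 0 <= s /\ a s = y.
  move=> y; have [y0|y0] := leP 0 y; last by exists 0.
  have [t t0 yt] := au y.
  have [||s] := @IVT _ a 0 t y t0.
  - apply: continuous_subspaceW ca => u /=.
    by rewrite !in_itv/= => /andP[->].
  - by have at0 := Kinf_ge0 Ka t0; rewrite a0 (min_idPl at0) (max_idPr at0) y0 ltW.
  - by rewrite in_itv/= => /andP[s0 _] asy; exists s.
have b0 y : 0 <= y -> 0 <= b y by move=> /bP[].
have abK y : 0 <= y -> a (b y) = y by move=> /bP[].
have baK s : 0 <= s -> b (a s) = s.
  move=> s0; have as0 := Kinf_ge0 Ka s0; have := abK _ as0.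
  by move=> e; apply/eqP; rewrite eq_le; apply/andP; split;
    apply: (Kinf_le_inv Ka); rewrite ?e// b0.
have bleP s y : 0 <= s -> 0 <= y -> (s <= b y) = (a s <= y).
  move=> s0 y0; rewrite -{2}(abK y y0); apply/idP/idP => [|].
    exact: Kinf_le.
  by apply: Kinf_le_inv => //; exact: b0.
have bltP s y : 0 <= s -> 0 <= y -> (b y < s) = (y < a s).
  by move=> s0 y0; rewrite !ltNge bleP.
exists b; last first.
  by move=> s y s0 asy; rewrite bleP// (le_trans _ asy)// (Kinf_ge0 Ka).
split.
- apply/within_ge0_continuousP => y.
  have m0 (u : R) : 0 <= Num.max 0 u by rewrite le_max lexx.
  have cm : Num.max 0 u @[u --> y] --> Num.max 0 y.
    by apply: (@continuous_max _ R (cst 0) id); [exact: cvg_cst|exact: cvg_id].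
  apply/cvgrPdist_lt => e e0.
  set s := b _; have s0 : 0 <= s by exact: b0.
  have aslt : Num.max 0 y < a (s + e).
    by rewrite -bltP ?addr_ge0 ?(ltW e0)// ltrDl.
  have up : \forall u \near y, Num.max 0 u < a (s + e).
    exact: (cvgr_lt _ cm).
  have lo : \forall u \near y, s - e < b (Num.max 0 u).
    (* Monotonicity of [a] is known only on [[0, +oo[], so [a (s - e)] can be used only for [s - e]
       nonnegative; otherwise nonnegativity of [b] suffices. *)
    have [se|se] := ltP (s - e) 0.
      by near=> u; rewrite (lt_le_trans se)// b0.
    have : a (s - e) < Num.max 0 y.
      by rewrite -[ltRHS]abK// -/s ai// gtrBl.
    move=> /(cvgr_gt _ cm) au_; near=> u.
    have au' : a (s - e) < Num.max 0 u by near: u; exact: au_.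
    rewrite ltNge; apply/negP => bu'.
    by have := Kinf_le Ka (b0 _ (m0 u)) bu'; rewrite abK// leNgt au'.
  near=> u.
  have bu' : b (Num.max 0 u) < s + e.
    by rewrite bltP ?addr_ge0 ?(ltW e0)//; near: u.
  have bl : s - e < b (Num.max 0 u) by near: u.
  by rewrite ltr_distlC -/s bl bu'.
- by rewrite -{1}a0 baK.
- move=> s t s0 st; have t0 := ltW (le_lt_trans s0 st).
  by rewrite ltNge bleP ?b0// abK// -ltNge.
- move=> M; have M0 : 0 <= `|M| + 1 by [].
  exists (a (`|M| + 1)); first exact: Kinf_ge0.
  by rewrite baK// ltr_pwDr// ler_norm.
Unshelve. all: by end_near. Qed.

(* If [r s < s + t], then [s] is below the inverse of [r - Id] at [t]. *)
Lemma Kinf_weak_triangle a r : Kinf a -> Kinf (fun s => r s - s) ->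
  exists2 b, Kinf b & forall s t, 0 <= s -> 0 <= t ->
    a (s + t) <= Num.max (a (r s)) (b t).
Proof.
move=> Ka Kr; have [k Kk kP] := Kinf_inverse Kr.
exists (fun t => a (k t + t)).
  by apply: Kinf_comp => //; apply: KinfD => //; exact: Kinf_id.
move=> s t s0 t0; rewrite le_max.
have [st|st] := leP (s + t) (r s); first by rewrite Kinf_le ?addr_ge0.
apply/orP; right; apply: Kinf_le => //; first by rewrite addr_ge0.
by rewrite lerD2r kP// lerBlDl ltW.
Qed.

(** Only [I1] is bounded; exchanging the indices gives the bound on [I2]. The additive form of the
    conclusion covers every branch of the maxima at once. *)
Lemma small_gain (g1 g2 r : R -> R) (c1 c2 : R) : 0 < c1 -> 0 < c2 ->
  Kinf g1 -> Kinf g2 -> Kinf r -> Kinf (fun s => r s - s) ->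
  Kinf (fun s => s - g1 (r (c2 * g2 (c1 * s)))) ->
  exists B G : R -> R, [/\ Kinf B, Kinf G &
    forall I1 I2 b1 b2 N1 N2 : R,
      0 <= I1 -> 0 <= I2 -> 0 <= b1 -> 0 <= b2 -> 0 <= N1 -> 0 <= N2 ->
      I1 <= Num.max b1 (g1 (c2 * I2 + N1)) ->
      I2 <= Num.max b2 (g2 (c1 * I1 + N2)) ->
      I1 <= b1 + B b2 + G (N1 + N2)].
Proof.
move=> c10 c20 Kg1 Kg2 Kr Kr' Kh.
have [k Kk kP] := Kinf_inverse Kh.
have [q Kq qP] := Kinf_weak_triangle Kg1 Kr'.
have KB : Kinf (fun s => g1 (r (c2 * s))).
  by do 2 apply: Kinf_comp => //; exact: Kinf_scale.
have c1V0 : 0 < c1^-1 by rewrite invr_gt0.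
have Kk' : Kinf (fun s => k (c1^-1 * s)).
  by apply: Kinf_comp => //; exact: Kinf_scale.
(* The first witness serves the branch [I2 <= b2]. In the second, [q] absorbs [N1] when it dominates
   in the weak triangle inequality for [g1], and [k], the inverse of the small-gain function,
   absorbs [N2] when the loop closes. *)
exists (fun s => g1 (r (c2 * s))), (fun s => q s + k (c1^-1 * s)).
split=> //; first exact: KinfD.
move=> I1 I2 b1 b2 N1 N2 I10 I20 b10 b20 N10 N20 I1le I2le.
have N0 : 0 <= N1 + N2 by rewrite addr_ge0.
have Bb0 := Kinf_ge0 KB b20.
have qN := Kinf_le Kq N10 (_ : N1 <= N1 + N2).
have {}qN : q N1 <= q (N1 + N2) by apply: qN; rewrite lerDl.
have q0 := Kinf_ge0 Kq N10.
have k0 := Kinf_ge0 Kk' N0.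
have kN : k (c1^-1 * N2) <= k (c1^-1 * (N1 + N2)).
  by apply: (Kinf_le Kk'); rewrite // lerDr.
move: I1le; rewrite le_max => /orP[|I1le]; first by lra.
have := qP _ _ (mulr_ge0 (ltW c20) I20) N10.
rewrite le_max => /orP[I1r|]; last by lra.
have I2r : I1 <= g1 (r (c2 * I2)) by exact: le_trans I1r.
move: I2le; rewrite le_max => /orP[I2b|I2g].
  have := Kinf_le KB I20 I2b; rewrite /=; lra.
(* With [s := I1 + N2 / c1] the loop inequality reads
   [s - N2 / c1 <= g1 (r (c2 * g2 (c1 * s)))]. *)
have s0 : 0 <= I1 + c1^-1 * N2 by rewrite addr_ge0// mulr_ge0// ltW.
have := Kinf_le KB I20 I2g; rewrite /=.
have -> : c1 * I1 + N2 = c1 * (I1 + c1^-1 * N2).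
  by rewrite mulrDr mulVKf// gt_eqF.
move=> loop.
have := kP _ (c1^-1 * N2) s0; rewrite lerBlDr => /(_ _).
have c1N2 : 0 <= c1^-1 * N2 by rewrite mulr_ge0// ltW.
have h : I1 + c1^-1 * N2 <= c1^-1 * N2 + g1 (r (c2 * g2 (c1 * (I1 + c1^-1 * N2)))).
  lra.
move=> /(_ h); lra.
Qed.

End Kinf_calculus.

(** * The Euclidean norm: Cauchy-Schwarz, the triangle inequality and blocks of coordinates *)

Section enorm_theory.
Context {R : realType}.

Lemma enorm_ge0 n (x : 'cV[R]_n) : 0 <= enorm x.
Proof. exact: sqrtr_ge0. Qed.

Lemma sqr_enorm n (x : 'cV[R]_n) : enorm x ^+ 2 = \sum_(i < n) x i ord0 ^+ 2.
Proof. by rewrite sqr_sqrtr// sumr_ge0// => i _; rewrite sqr_ge0. Qed.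

Lemma ler_enorm_coord n (x : 'cV[R]_n) i : `|x i ord0| <= enorm x.
Proof.
rewrite -sqrtr_sqr ler_wsqrtr// (bigD1 i)//= lerDl sumr_ge0// => j _.
by rewrite sqr_ge0.
Qed.

Lemma enorm_dot n (x y : 'cV[R]_n) :
  \sum_(i < n) x i ord0 * y i ord0 <= enorm x * enorm y.
Proof.
have dot0 (u v : 'cV[R]_n) : enorm u = 0 -> \sum_(i < n) u i ord0 * v i ord0 = 0.
  move=> u0; rewrite big1// => i _.
  have := ler_enorm_coord u i.
  by rewrite u0 normr_le0 => /eqP ->; rewrite mul0r.
have [x0|x0] := eqVneq (enorm x) 0; first by rewrite x0 dot0// mul0r.
have [y0|y0] := eqVneq (enorm y) 0.
  by rewrite y0 mulr0; under eq_bigr do rewrite mulrC; rewrite dot0.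
have xp : 0 < enorm x by rewrite lt_def x0 enorm_ge0.
have yp : 0 < enorm y by rewrite lt_def y0 enorm_ge0.
have : 0 <= \sum_(i < n) (enorm y * x i ord0 - enorm x * y i ord0) ^+ 2.
  by rewrite sumr_ge0// => i _; rewrite sqr_ge0.
under eq_bigr do rewrite sqrrB !exprMn.
rewrite big_split sumrB/= -!mulr_sumr -!sqr_enorm.
rewrite (_ : \sum_(i < n) _ =
  2 * (enorm x * enorm y) * (\sum_(i < n) x i ord0 * y i ord0)); last first.
  by rewrite mulr_sumr; apply: eq_bigr => i _; ring.
move=> h; rewrite -(ler_pM2l (_ : 0 < 2 * (enorm x * enorm y))) ?mulr_gt0//.
lra.
Qed.

Lemma ler_enormD n (x y : 'cV[R]_n) : enorm (x + y) <= enorm x + enorm y.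
Proof.
rewrite -(@ler_pXn2r _ 2)// ?nnegrE ?addr_ge0 ?enorm_ge0//.
rewrite sqrrD !sqr_enorm; under eq_bigr do rewrite mxE sqrrD.
by rewrite !big_split/= lerD2r lerD2l -mulr2n lerMn2r enorm_dot.
Qed.

(** By injectivity each squared coordinate is counted at most once. Working with [rowsub] treats the
    upper and lower blocks of a vector uniformly. *)
Lemma enorm_rowsub m n (f : 'I_m -> 'I_n) (x : 'cV[R]_n) : injective f ->
  enorm (rowsub f x) <= enorm x.
Proof.
move=> finj; rewrite ler_wsqrtr//.
under eq_bigr do rewrite mxE.
rewrite [leRHS](bigID (mem (f @: 'I_m)))/= big_imset/=; last exact: in2W.
by rewrite lerDl sumr_ge0// => i _; rewrite sqr_ge0.
Qed.

Lemma enorm_col_mx n1 n2 (x : 'cV[R]_(n1 + n2)) :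
  enorm x <= enorm (usubmx x) + enorm (dsubmx x).
Proof.
rewrite -(@ler_pXn2r _ 2)// ?nnegrE ?addr_ge0 ?enorm_ge0//.
rewrite sqrrD !sqr_enorm big_split_ord/=.
under [X in _ <= X + _ + _]eq_bigr do rewrite mxE.
under [X in _ <= _ + X]eq_bigr do rewrite mxE.
by rewrite addrAC lerDl mulrn_wge0// mulr_ge0// enorm_ge0.
Qed.

End enorm_theory.

(** * Inputs, solutions and integrals with respect to the completed Lebesgue measure *)

Section lebesgue.
Context {R : realType}.
Local Notation leb := (@completed_lebesgue_measure R).

#[local] Instance ae_leb_filter : Filter (nbhs (almost_everywhere leb)).
Proof. exact: (@ae_filter_ringOfSetsType _ (lebesgueType R)). Qed.

Lemma lebesgueType_measurable (A : set R) :
  measurable A -> measurable (A : set (lebesgueType R)).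
Proof. exact: sub_caratheodory. Qed.

Lemma continuous_lebesgue_measurable (D : set (lebesgueType R)) (f : R -> R) :
  measurable D -> continuous f -> measurable_fun D (f : lebesgueType R -> R).
Proof.
move=> mD cf _ B mB; apply: measurableI => //.
apply: lebesgueType_measurable; rewrite -[X in measurable X]setTI.
exact: continuous_measurable_fun.
Qed.

Lemma leb_itv_fin (a b : R) :
  (leb `[a, b] < +oo)%E.
Proof.
have -> : leb `[a, b] = lebesgue_measure (`[a, b] : set R) by [].
by rewrite lebesgue_measure_itv/=; case: ifP => // _; rewrite -EFinB ltry.
Qed.

Lemma inputsD m (v w : R -> 'cV[R]_m) : inputs v -> inputs w ->
  inputs (fun t => v t + w t).
Proof.
move=> [mv bv] [mw bw]; split.
  move=> i; apply: eq_measurable_fun (measurable_funD (mv i) (mw i)) => t _.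
  by rewrite mxE.
move=> T T0; have [M vM] := bv T T0; have [N wN] := bw T T0.
exists (M + N).
move: vM wN; apply: filterS2 => t vM wN tT.
by rewrite (le_trans (ler_enormD _ _))// lerD// (vM,wN).
Qed.

Lemma inputs_rowsub m n (f : 'I_m -> 'I_n) (w : R -> 'cV[R]_n) : injective f ->
  inputs w -> inputs (fun t => rowsub f (w t)).
Proof.
move=> finj [mw bw]; split.
  by move=> i; apply: eq_measurable_fun (mw (f i)) => t _; rewrite mxE.
move=> T T0; have [M wM] := bw T T0.
exists M.
move: wM; apply: filterS => t wM tT.
by rewrite (le_trans (enorm_rowsub _ finj))// wM.
Qed.

(** Absolute continuity tested on a single interval is uniform continuity, and a coordinate is
    dominated by the norm. *)
Lemma abs_continuous_coord n (x : R -> 'cV[R]_n) i :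
  (forall T, 0 <= T -> abs_continuous T x) ->
  {within `[0, +oo[, continuous (fun t : R => x t i ord0)}.
Proof.
move=> acx.
apply/within_ge0_continuousP => t.
have cm : Num.max 0 u @[u --> t] --> Num.max 0 t.
  by apply: (@continuous_max _ R (cst 0) id); [exact: cvg_cst|exact: cvg_id].
have m0 (u : R) : 0 <= Num.max 0 u by rewrite le_max lexx.
apply/cvgrPdist_lt => e e0.
(* The margin 1 keeps all points near [t], on both sides, within the horizon. *)
have T0 : 0 <= Num.max 0 t + 1 by rewrite addr_ge0.
have [d d0 dP] := acx _ T0 _ e0.
have {}dP a b : 0 <= a -> a <= b -> b <= Num.max 0 t + 1 -> b - a < d ->
    enorm (x b - x a) < e.
  move=> a0 ab bT bad.
  have := dP 1%N (fun=> a) (fun=> b).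
  rewrite !big_ord1; apply => //.
  by move=> j k; rewrite !ord1 eqxx.
have {}dP a b : 0 <= a -> 0 <= b -> a <= Num.max 0 t + 1 -> b <= Num.max 0 t + 1 ->
    `|b - a| < d -> `|x b i ord0 - x a i ord0| < e.
  move=> a0 b0 aT bT.
  wlog ab : a b a0 b0 aT bT / a <= b.
    move=> wlg; have [ab|ba] := leP a b; first exact: wlg.
    by rewrite distrC (distrC (x b i ord0)); apply: wlg => //; exact: ltW.
  move=> bad.
  have := ler_enorm_coord (x b - x a) i; rewrite !mxE => /le_lt_trans; apply.
  by apply: dP => //; rewrite (le_lt_trans _ bad)// ler_norm.
near=> u.
apply: dP => //.
- by rewrite ltW//; near: u; apply: (cvgr_lt _ cm); rewrite ltrDl.
- by rewrite lerDl.
- by near: u; exact: (@cvgr_dist_lt _ _ _ _ _ _ _ cm).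
Unshelve. all: by end_near. Qed.

(** Each state can thus drive the other subsystem. Continuity of the coordinates yields
    measurability, and compactness of segments yields boundedness. *)
Lemma solution_inputs n m (f : 'cV[R]_n -> 'cV[R]_m -> 'cV[R]_n) w x :
  solution f w x -> inputs x.
Proof.
move=> [acx _].
have mI : measurable (`[0, +oo[ : set (lebesgueType R)).
  exact: lebesgueType_measurable.
split=> [i|T T0].
  have cx : continuous (fun t : R => x (Num.max 0 t) i ord0).
    by apply/(within_ge0_continuousP (fun t => x t i ord0)); exact: abs_continuous_coord.
  apply: eq_measurable_fun (continuous_lebesgue_measurable mI cx) => t.
  by rewrite inE/= in_itv/= andbT => t0; rewrite (max_idPr t0).
have /choice[M MP] : forall i : 'I_n, exists M : R,
    forall t, 0 <= t <= T -> `|x t i ord0| <= M.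
  move=> i; have /compact_bounded : compact ((fun t : R => x t i ord0) @` `[0, T]).
    apply: continuous_compact; last exact: segment_compact.
    apply: continuous_subspaceW (abs_continuous_coord acx) => t /=.
    by rewrite !in_itv/= => /andP[->].
  (* Only numbers strictly above [M] are known to be bounds, hence [M + 1]. *)
  move=> [M [_ MP]]; exists (M + 1) => t tT.
  apply: (MP (M + 1)); first by rewrite ltrDl.
  by exists t => //=; rewrite in_itv.
exists (Num.sqrt (\sum_(i < n) M i ^+ 2)).
apply: aeW => t tT; rewrite ler_wsqrtr// ler_sum// => i _.
rewrite -(real_normK (num_real _)) lerXn2r// ?nnegrE ?MP//.
by rewrite (le_trans _ (MP _ _ tT)).
Qed.

(** The integrand is measurable and essentially bounded on a set of finite measure. This justifies
    adding and comparing the real-valued integrals. *)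
Lemma Kinf_inputs_integrable m (s : R -> R) (w : R -> 'cV[R]_m) (T : R) :
  Kinf s -> inputs w -> 0 <= T ->
  leb.-integrable `[0, T] (fun t : lebesgueType R => (s (enorm (w t)))%:E).
Proof.
move=> Ks [mw bw] T0; have [M wM] := bw _ T0.
have mI : measurable (`[0, T] : set (lebesgueType R)).
  exact: lebesgueType_measurable.
have msw : measurable_fun (`[0, T] : set (lebesgueType R))
    (fun t : lebesgueType R => s (enorm (w t))).
  have ms : measurable_fun setT (fun u : R => s (Num.max 0 u)).
    apply: continuous_measurable_fun.
    by apply/within_ge0_continuousP; case: Ks.
  have mn : measurable_fun (`[0, T] : set (lebesgueType R))
      (fun t : lebesgueType R => enorm (w t)).
    apply: (@measurableT_comp _ _ _ _ _ _ (@Num.sqrt R)).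
      by apply: continuous_measurable_fun; exact: sqrt_continuous.
    apply: measurable_sum => i; apply: measurable_funX.
    apply: measurable_funS (mw i).
      exact: lebesgueType_measurable.
    by move=> t /=; rewrite !in_itv/= => /andP[->].
  apply: eq_measurable_fun (measurableT_comp ms mn) => t _ /=.
  by rewrite (max_idPr (enorm_ge0 _)).
apply/integrableP; split; first exact/measurable_EFinP.
(* The essential bound [M] may be negative when [T = 0], the segment then being a null set; hence
   the clamp. *)
apply: (@le_lt_trans _ _ ((s (Num.max 0 M))%:E * leb `[0%R, T])%E).
  apply: integral_le_bound => //.
  - by apply/measurable_EFinP.
  - by rewrite lee_fin (Kinf_ge0 Ks)// le_max lexx.
  - move: wM; apply: filterS => t wM; rewrite /= in_itv/= => tT.
    rewrite lee_fin ger0_norm ?(Kinf_ge0 Ks) ?enorm_ge0//.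
    by rewrite (Kinf_le Ks) ?enorm_ge0// le_max wM// orbT.
by rewrite lte_mul_pinfty ?leb_itv_fin// ?lee_fin ?(Kinf_ge0 Ks)// le_max lexx.
Qed.

Lemma is_derive_rowsub m n (g : 'I_m -> 'I_n) (x : R -> 'cV[R]_n) (t : R) d :
  is_derive t 1 x d -> is_derive t 1 (fun u => rowsub g (x u)) (rowsub g d).
Proof.
move=> [dx <-].
have dgx : derivable (fun u => rowsub g (x u)) t 1.
  apply/derivable_mxP => i j; move/derivable_mxP : dx => /(_ (g i) j).
  by under [X in _ -> derivable X _ _]eq_fun do rewrite mxE.
apply: DeriveDef => //.
rewrite !derive_mx//; apply/matrixP => i j; rewrite !mxE.
by under eq_fun do rewrite mxE.
Qed.

(** Extracts the trajectories of the subsystems from one of the interconnection. Row selection is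
    linear and does not increase the norm, so the same [d] witnesses absolute continuity. *)
Lemma solution_rowsub n m n' m' (f : 'cV[R]_n -> 'cV[R]_m -> 'cV[R]_n)
    (f' : 'cV[R]_n' -> 'cV[R]_m' -> 'cV[R]_n') w w' x (g : 'I_n' -> 'I_n) :
  injective g ->
  (forall t, rowsub g (f (x t) (w t)) = f' (rowsub g (x t)) (w' t)) ->
  solution f w x -> solution f' w' (fun t => rowsub g (x t)).
Proof.
move=> ginj fE [acx dx]; split.
  move=> T T0 e e0; have [d d0 dP] := acx T T0 e e0.
  exists d => // k a b ab disj abd.
  apply: le_lt_trans (dP k a b ab disj abd); apply: ler_sum => i _.
  by rewrite -raddfB/= enorm_rowsub.
move: dx; apply: filterS => t dx t0; rewrite -fE.
exact/is_derive_rowsub/dx.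
Qed.

(** Pointwise, [s (|y + v|) <= max (s (r |y|)) (tau |v|) <= c * a' |y| + tau |v|]; this is
    integrated inside the monotone [g]. *)
Lemma subsystem_estimate n m (f : 'cV[R]_n -> 'cV[R]_m -> 'cV[R]_n)
    (a b g s r tau a' : R -> R) (c : R) x (y v : R -> 'cV[R]_m) (t : R) :
  Kinf s -> Kinf g -> Kinf tau -> Kinf a' -> 0 < c ->
  (forall p q, 0 <= p -> 0 <= q -> s (p + q) <= Num.max (s (r p)) (tau q)) ->
  (forall p, 0 <= p -> s (r p) <= c * a' p) ->
  iISS_estimate f a b g s ->
  inputs y -> inputs v -> solution f (fun u => y u + v u) x -> 0 <= t ->
  \int[leb]_(u in `[0, t]) a (enorm (x u)) <=
  Num.max (b (enorm (x 0)))
          (g (c * \int[leb]_(u in `[0, t]) a' (enorm (y u)) +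
              \int[leb]_(u in `[0, t]) tau (enorm (v u)))).
Proof.
move=> Ks Kg Ktau Ka' c0 sP srP fP iy iv fx t0.
have iyv := inputsD iy iv.
apply: le_trans (fP _ _ _ iyv fx t0) _.
rewrite ge_max le_max lexx/= le_max; apply/orP; right.
apply: (Kinf_le Kg).
  by apply: Rintegral_ge0 => u _; rewrite (Kinf_ge0 Ks) ?enorm_ge0.
have mI : measurable (`[0, t] : set (lebesgueType R)).
  exact: lebesgueType_measurable.
have Ica := Kinf_inputs_integrable (Kinf_comp (Kinf_scale c0) Ka') iy t0.
have Itau := Kinf_inputs_integrable Ktau iv t0.
rewrite -RintegralZl//; last exact: Kinf_inputs_integrable.
rewrite -RintegralD//.
apply: le_Rintegral => //.
- exact: Kinf_inputs_integrable.
- exact: (integrableD mI Ica Itau).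
move=> u _.
have y0 := enorm_ge0 (y u); have v0 := enorm_ge0 (v u).
apply: (le_trans (Kinf_le Ks (enorm_ge0 _) (ler_enormD _ _))).
apply: (le_trans (sP _ _ y0 v0)).
have := srP _ y0; have := Kinf_ge0 Ktau v0.
have : 0 <= c * a' (enorm (y u)) by rewrite mulr_ge0 ?(Kinf_ge0 Ka')// ltW.
by rewrite ge_max => ? ? ?; apply/andP; split; lra.
Qed.

End lebesgue.

(** * Assembly of the two subsystem bounds into an estimate for the interconnection *)

Unset Implicit Arguments.

Theorem theorem12 (R : realType) (n1 n2 : nat)
    (f1 : 'cV[R]_n1 -> 'cV[R]_n2 -> 'cV[R]_n1)
    (f2 : 'cV[R]_n2 -> 'cV[R]_n1 -> 'cV[R]_n2)
    (alpha1 beta1 gamma1 sigma1 alpha2 beta2 gamma2 sigma2 : R -> R)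
    (Hlip1 : loc_lipschitz1 f1) (Hlip2 : loc_lipschitz1 f2)
    (Hfc1 : forward_complete f1) (Hfc2 : forward_complete f2)
    (HK1 : [/\ Kinf alpha1, Kinf beta1, Kinf gamma1 & Kinf sigma1])
    (HK2 : [/\ Kinf alpha2, Kinf beta2, Kinf gamma2 & Kinf sigma2])
    (HiISS1 : iISS_estimate f1 alpha1 beta1 gamma1 sigma1)
    (HiISS2 : iISS_estimate f2 alpha2 beta2 gamma2 sigma2)
    (Hfc : forward_complete (feedback f1 f2))
    (Hmatch : exists c1 c2 : R, exists rho1 rho2 : R -> R,
      [/\ 0 < c1, 0 < c2,
          Kinf rho1 /\ Kinf (fun s => rho1 s - s),
          Kinf rho2 /\ Kinf (fun s => rho2 s - s) &
      [/\ forall s : R, 0 <= s -> sigma1 (rho1 s) <= c2 * alpha2 s,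
          forall s : R, 0 <= s -> sigma2 (rho2 s) <= c1 * alpha1 s &
          exists rho : R -> R,
          [/\ Kinf rho, Kinf (fun s => rho s - s),
              Kinf (fun s => s - gamma1 (rho (c2 * gamma2 (c1 * s)))) &
              Kinf (fun s => s - gamma2 (rho (c1 * gamma1 (c2 * s))))]]]) :
  iISS (feedback f1 f2).
Proof.
have [Ka1 Kb1 Kg1 Ks1] := HK1; have [Ka2 Kb2 Kg2 Ks2] := HK2.
case: Hmatch => c1 [c2 [rho1 [rho2 [c10 c20 [_ Kr1] [_ Kr2]]]]].
move=> [m1 m2 [rho [Kr Kr' Ksg1 Ksg2]]].
have [tau1 Kt1 tau1P] := Kinf_weak_triangle Ks1 Kr1.
have [tau2 Kt2 tau2P] := Kinf_weak_triangle Ks2 Kr2.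
have [B1 [G1 [KB1 KG1 sg1]]] := small_gain c10 c20 Kg1 Kg2 Kr Kr' Ksg1.
have [B2 [G2 [KB2 KG2 sg2]]] := small_gain c20 c10 Kg2 Kg1 Kr Kr' Ksg2.
have half0 : 0 < 2^-1 :> R by rewrite invr_gt0.
have two0 : 0 < 2 :> R by [].
(* As [|x| <= |x1| + |x2|], one block has at least half the norm of [x]; the minimum makes either
   block sufficient. *)
pose a s := Num.min (alpha1 (2^-1 * s)) (alpha2 (2^-1 * s)).
have Ka : Kinf a by apply: Kinf_min; apply: Kinf_comp => //; exact: Kinf_scale.
(* [b] and [g] gather the initial-state and input terms of the bounds on both integrals. The factor
   2 turns a sum into a maximum: [p + q <= max (2 p) (2 q)]. *)
pose b s := 2 * (beta1 s + B1 (beta2 s) + (beta2 s + B2 (beta1 s))).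
have Kb : Kinf b.
  apply: (Kinf_comp (Kinf_scale two0)).
  by do 2 apply: KinfD => //; try exact: Kinf_comp.
pose g s := 2 * (G1 s + G2 s).
have Kg : Kinf g by apply: (Kinf_comp (Kinf_scale two0)); exact: KinfD.
have Kt := KinfD Kt1 Kt2.
exists a, b, g, (fun s => tau1 s + tau2 s); split=> // w x t iw fx t0.
have lI := @lshift_inj n1 n2; have rI := @rshift_inj n1 n2.
have ix := solution_inputs fx.
pose x1 u := rowsub (lshift n2) (x u); pose x2 u := rowsub (@rshift n1 n2) (x u).
pose v1 u := rowsub (lshift n1) (w u); pose v2 u := rowsub (@rshift n2 n1) (w u).
have ix1 : inputs x1 by exact: inputs_rowsub.
have ix2 : inputs x2 by exact: inputs_rowsub.
have iv1 : inputs v1 by apply: inputs_rowsub => //; exact: lshift_inj.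
have iv2 : inputs v2 by apply: inputs_rowsub => //; exact: rshift_inj.
have fx1 : solution f1 (fun u => x2 u + v1 u) x1.
  apply: solution_rowsub fx => // u.
  by rewrite -usubmxEsub col_mxKu /x2 /v1 -!usubmxEsub -dsubmxEsub.
have fx2 : solution f2 (fun u => x1 u + v2 u) x2.
  apply: solution_rowsub fx => // u.
  by rewrite -dsubmxEsub col_mxKd /x1 /v2 -!dsubmxEsub -usubmxEsub.
have est1 := subsystem_estimate Ks1 Kg1 Kt1 Ka2 c20 tau1P m1 HiISS1 ix2 iv1 fx1 t0.
have est2 := subsystem_estimate Ks2 Kg2 Kt2 Ka1 c10 tau2P m2 HiISS2 ix1 iv2 fx2 t0.
have mI : measurable (`[0, t] : set (lebesgueType R)).
  exact: lebesgueType_measurable.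
set I1 := Rintegral _ _ _ in est1 est2; set I2 := Rintegral _ _ _ in est1 est2.
set N1 := Rintegral _ _ _ in est1; set N2 := Rintegral _ _ _ in est2.
set N := Rintegral _ _ (fun r => tau1 _ + tau2 _).
have int_ge0 m (s : R -> R) (v : R -> 'cV[R]_m) : Kinf s ->
    0 <= \int[completed_lebesgue_measure]_(u in `[0, t]) s (enorm (v u)).
  by move=> Ks; apply: Rintegral_ge0 => u _; rewrite (Kinf_ge0 Ks) ?enorm_ge0.
have I10 : 0 <= I1 by exact: int_ge0.
have I20 : 0 <= I2 by exact: int_ge0.
have N10 : 0 <= N1 by exact: int_ge0.
have N20 : 0 <= N2 by exact: int_ge0.
(* Each block of the external input has norm at most that of the whole, so one integral of
   [tau1 + tau2] dominates both input terms. *)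
have N12 : N1 + N2 <= N.
  have In1 := Kinf_inputs_integrable Kt1 iv1 t0.
  have In2 := Kinf_inputs_integrable Kt2 iv2 t0.
  rewrite -RintegralD//; apply: le_Rintegral => //.
  - exact: (integrableD mI In1 In2).
  - exact: (Kinf_inputs_integrable Kt iw t0).
  - by move=> u _; apply: lerD; apply: Kinf_le; rewrite ?enorm_ge0 ?enorm_rowsub//;
      [exact: lshift_inj|exact: rshift_inj].
have aI : \int[completed_lebesgue_measure]_(r in `[0, t]) a (enorm (x r)) <= I1 + I2.
  have Ia1 := Kinf_inputs_integrable Ka1 ix1 t0.
  have Ia2 := Kinf_inputs_integrable Ka2 ix2 t0.
  rewrite -RintegralD//; apply: le_Rintegral => //.
  - exact: (Kinf_inputs_integrable Ka ix t0).
  - exact: (integrableD mI Ia1 Ia2).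
  - move=> u _; have := enorm_col_mx (x u).
    rewrite usubmxEsub dsubmxEsub -/(x1 u) -/(x2 u) => xu.
    have n0 := enorm_ge0 (x u); have n10 := enorm_ge0 (x1 u).
    have n20 := enorm_ge0 (x2 u).
    have a10 := Kinf_ge0 Ka1 n10; have a20 := Kinf_ge0 Ka2 n20.
    have h0 : 0 <= 2^-1 * enorm (x u) by rewrite mulr_ge0// ltW.
    rewrite ge_min; apply/orP.
    have [le1|lt1] := leP (2^-1 * enorm (x u)) (enorm (x1 u)).
      by left; rewrite (le_trans (Kinf_le Ka1 h0 le1))// lerDl.
    have le2 : 2^-1 * enorm (x u) <= enorm (x2 u) by lra.
    by right; rewrite (le_trans (Kinf_le Ka2 h0 le2))// lerDr.
have x10 := enorm_ge0 (x1 0); have x20 := enorm_ge0 (x2 0).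
have x1le : enorm (x1 0) <= enorm (x 0) by exact: enorm_rowsub.
have x2le : enorm (x2 0) <= enorm (x 0) by exact: enorm_rowsub.
have b10 := Kinf_ge0 Kb1 x10; have b20 := Kinf_ge0 Kb2 x20.
have b1le := Kinf_le Kb1 x10 x1le; have b2le := Kinf_le Kb2 x20 x2le.
have I1le := sg1 _ _ _ _ _ _ I10 I20 b10 b20 N10 N20 est1 est2.
have I2le := sg2 _ _ _ _ _ _ I20 I10 b20 b10 N20 N10 est2 est1.
have N0 : 0 <= N1 + N2 by rewrite addr_ge0.
have G1le := Kinf_le KG1 N0 N12; have G2le := Kinf_le KG2 N0 N12.
have B1le := Kinf_le KB1 b20 b2le; have B2le := Kinf_le KB2 b10 b1le.
rewrite (addrC N2) in I2le.
apply: (le_trans aI); rewrite le_max /b /g; apply/orP.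
have [bg|gb] := leP (G1 N + G2 N) (beta1 (enorm (x 0)) + B1 (beta2 (enorm (x 0)))
    + (beta2 (enorm (x 0)) + B2 (beta1 (enorm (x 0))))); [left|right]; lra.
Qed.
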